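(* Let $f=\frac1n\sum_{i=1}^n f_i$ where each $f_i:\mathbb{R}^d\to\mathbb{R}$ is convex and $L_i$-smooth, let $x^*$ be a minimizer of $f$, and let $L_{\max}=\max_{1\le i\le n}L_i$. Let $c=1$, $\gamma_b\in(0,\infty)$ and $\alpha=\min\left\{\frac{1}{2cL_{\max}},\gamma_b\right\}$. Then the iterates of SGD with $\text{SPS}_{\max}$ (with parameters $c=1$ and $\gamma_b$) satisfy, for every $K\ge1$, $$\mathbb{E}\left[f(\bar{x}^K)-f(x^* )\right]\le\frac{\|x^0-x^*\|^2}{\alpha K}+\frac{2\sigma^2\gamma_b}{\alpha},\qquad \bar{x}^K:=\frac1K\sum_{k=0}^{K-1}x^k.$$
   Context: Setting: $f(x)=\frac1n\sum_{i=1}^n f_i(x)$ is minimized over $\mathbb{R}^d$, and the set $\mathcal{X}^*$ of minimizers of $f$ is nonempty. A function is $L$-smooth if it is differentiable with $L$-Lipschitz gradient. For each $i$, $f_i^*:=\inf_x f_i(x)$, and it is assumed throughout that $\sigma^2:=\mathbb{E}_i[f_i(x^* )-f_i^*]=f(x^* )-\frac1n\sum_{i=1}^n f_i^*<\infty$ (so all $f_i^*$ are finite), where $x^*\in\mathcal{X}^*$. SGD: starting from a deterministic $x^0$, at each iteration $k$ an index $i\in\{1,\dots,n\}$ is drawn uniformly at random, independently of the past, and $x^{k+1}=x^k-\gamma_k\nabla f_i(x^k)$. $\text{SPS}_{\max}$ with parameters $c>0$ and $\gamma_b>0$: $\gamma_k=\min\left\{\frac{f_i(x^k)-f_i^*}{c\|\nabla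 f_i(x^k)\|^2},\gamma_b\right\}$, where $i$ is the index drawn at iteration $k$. If $\nabla f_i(x^k)=0$ then $x^{k+1}=x^k$. *)

(* Defs.v *)
From mathcomp Require Import all_boot all_order all_algebra.
From mathcomp Require Import all_classical all_reals all_analysis.
Import Order.TTheory GRing.Theory Num.Theory.
Import numFieldNormedType.Exports.

Set Implicit Arguments.
Unset Strict Implicit.
Unset Printing Implicit Defensive.

Local Open Scope classical_set_scope.
Local Open Scope ring_scope.

Section Smoothness.
Context {R : realType} {d : nat}.
Implicit Types (g : 'rV[R]_d -> R) (x v : 'rV[R]_d).

(* The library norm `|v| on 'rV[R]_d is the sup norm, hence this one. *)
Definition enorm v : R := Num.sqrt (\sum_j v 0 j ^+ 2).

Definition grad g x : 'rV[R]_d := \row_j 'D_(delta_mx 0 j) g x.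

Definition smooth (L : R) g : Prop :=
  (forall x, differentiable g x) /\
  (forall x y, enorm (grad g x - grad g y) <= L * enorm (x - y)).

End Smoothness.

Section FiniteSum.
Context {R : realType} {n d : nat}.
Implicit Types (f : 'I_n.+1 -> 'rV[R]_d -> R) (x : 'rV[R]_d).

Definition average (a : 'I_n.+1 -> R) : R := n.+1%:R^-1 * \sum_i a i.

Definition objective f x : R := average (fun i => f i x).

(* [inf] is the genuine infimum only for functions bounded below. *)
Definition infval (g : 'rV[R]_d -> R) : R := inf (range g).

Definition sigma2 f x : R := average (fun i => f i x - infval (f i)).

Definition max_const (L : 'I_n.+1 -> R) : R := \big[Num.max/L ord0]_i L i.

(* If Lmax = 0 then alpha = 0 because 1 / 0 = 0, and a bound a / alpha reads 0;
   for a >= 0 this is stronger than the bound under the convention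
   1 / 0 = +oo. *)
Definition alpha (c gamma_b Lmax : R) : R :=
  Num.min (1 / (2 * c * Lmax)) gamma_b.

Definition sps_max (c gamma_b : R) (g : 'rV[R]_d -> R) x : R :=
  Num.min ((g x - infval g) / (c * enorm (grad g x) ^+ 2)) gamma_b.

Definition sgd_step (c gamma_b : R) (g : 'rV[R]_d -> R) x : 'rV[R]_d :=
  if grad g x == 0 then x else x - sps_max c gamma_b g x *: grad g x.

Fixpoint sgd (c gamma_b : R) f (x0 : 'rV[R]_d) (i : nat -> 'I_n.+1) (k : nat)
    : 'rV[R]_d :=
  if k is k'.+1 then
    sgd_step c gamma_b (f (i k')) (sgd c gamma_b f x0 i k')
  else x0.

Definition mean_iterate (x : nat -> 'rV[R]_d) (K : nat) : 'rV[R]_d :=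
  K%:R^-1 *: \sum_(k < K) x k.

End FiniteSum.

Section UniformSampling.
Context {R : realType} {disp : measure_display} {Omega : measurableType disp}.
Context (P : probability Omega R) {n : nat}.
Implicit Type I : nat -> Omega -> 'I_n.+1.

(* 'I_n.+1 carries its discrete sigma-algebra, so that the events generated by
   I k are the preimages of arbitrary sets of indices. *)
Definition mutually_independent I : Prop :=
  forall (s : seq nat) (A : nat -> set 'I_n.+1), uniq s ->
    P (\bigcap_(k in [set` s]) I k @^-1` A k) =
    (\prod_(k <- s) P (I k @^-1` A k))%E.

Definition iid_uniform I : Prop :=
  [/\ forall k i, measurable (I k @^-1` [set i]),
      forall k i, P (I k @^-1` [set i]) = (n.+1%:R^-1)%:E
    & mutually_independent I].

End UniformSampling.

(* Main.v *)
(* Write f_i' for the infimum of f_i, and z for the minimizer. Convexity and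
   gamma |grad f_i(x)|^2 <= f_i(x) - f_i' give, for the step size gamma,
     |x+ - z|^2 <= |x - z|^2 - gamma (f_i(x) - f_i') + 2 gamma (f_i(z) - f_i').
   Smoothness gives f_i(x) - f_i' >= |grad f_i(x)|^2 / (2 L_i), so that
   alpha <= gamma <= gamma_b; averaging over i, telescoping over the iterations
   and Jensen's inequality finish the proof. The first K draws take finitely
   many values, so all expectations are averages over K-tuples of indices. If
   max L_i <= 0, every f_i is constant. *)
Require Import Defs.
From mathcomp Require Import all_boot all_order all_algebra.
From mathcomp Require Import all_classical all_reals all_analysis.
From mathcomp Require Import ring lra.
Import Order.TTheory GRing.Theory Num.Theory.
Import numFieldNormedType.Exports.

Set Implicit Arguments.
Unset Strict Implicit.
Unset Printing Implicit Defensive.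

Local Open Scope classical_set_scope.
Local Open Scope ring_scope.

(** * Euclidean inner product and the Cauchy-Schwarz inequality *)

Section InnerProduct.
Context {R : realType} {d : nat}.
Implicit Types (u v w : 'rV[R]_d) (a : R).

Definition dot u v : R := \sum_j u 0 j * v 0 j.

Lemma dotC u v : dot u v = dot v u.
Proof. by apply: eq_bigr => j _; rewrite mulrC. Qed.

Lemma dotDl u v w : dot (u + v) w = dot u w + dot v w.
Proof. by rewrite -big_split; apply: eq_bigr => j _; rewrite mxE mulrDl. Qed.

Lemma dotZl a u v : dot (a *: u) v = a * dot u v.
Proof. by rewrite mulr_sumr; apply: eq_bigr => j _; rewrite mxE mulrA. Qed.

Lemma dotNl u v : dot (- u) v = - dot u v.
Proof. by rewrite -scaleN1r dotZl mulN1r. Qed.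

Lemma dotDr u v w : dot u (v + w) = dot u v + dot u w.
Proof. by rewrite dotC dotDl !(dotC u). Qed.

Lemma dotZr a u v : dot u (a *: v) = a * dot u v.
Proof. by rewrite dotC dotZl dotC. Qed.

Lemma dotNr u v : dot u (- v) = - dot u v.
Proof. by rewrite dotC dotNl dotC. Qed.

Definition dotE := (dotDl, dotDr, dotNl, dotNr, dotZl, dotZr).

Lemma dot0l u : dot 0 u = 0.
Proof. by rewrite -(scale0r u) dotZl mul0r. Qed.

Lemma dot_ge0 u : 0 <= dot u u.
Proof. by apply: sumr_ge0 => j _; rewrite -expr2 sqr_ge0. Qed.

Lemma dot_eq0 u : (dot u u == 0) = (u == 0).
Proof.
apply/eqP/eqP => [|->]; last exact: dot0l.
move=> /psumr_eq0P u0; apply/rowP => j; rewrite mxE; apply/eqP.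
by rewrite -sqrf_eq0 expr2 u0// => k _; rewrite -expr2 sqr_ge0.
Qed.

Lemma enorm_ge0 u : 0 <= enorm u.
Proof. exact: sqrtr_ge0. Qed.

Lemma sqr_enorm u : enorm u ^+ 2 = dot u u.
Proof.
rewrite sqr_sqrtr; last by apply: sumr_ge0 => j _; exact: sqr_ge0.
by apply: eq_bigr => j _; rewrite expr2.
Qed.

Lemma enorm_eq0 u : (enorm u == 0) = (u == 0).
Proof. by rewrite -sqrf_eq0 sqr_enorm dot_eq0. Qed.

Lemma enormZ a u : enorm (a *: u) = `|a| * enorm u.
Proof.
apply/eqP; rewrite -(eqrXn2 (n := 2)) ?mulr_ge0 ?enorm_ge0//.
by rewrite exprMn !sqr_enorm !dotE real_normK ?num_real// expr2 mulrA.
Qed.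

(** Expand $\bigl||v|u-|u|v\bigr|^2\ge0$ and divide by $2|u||v|$; if this product vanishes, one of
    the vectors is zero. *)
Lemma dot_le_enorm u v : dot u v <= enorm u * enorm v.
Proof.
have := dot_ge0 (enorm v *: u - enorm u *: v).
rewrite !dotE (dotC v u) -!sqr_enorm.
have := mulr_ge0 (enorm_ge0 u) (enorm_ge0 v).
rewrite le_eqVlt => /predU1P[/esym/eqP|uv0 H].
  rewrite mulf_eq0 => /orP[]; rewrite enorm_eq0 => /eqP-> _.
  - by rewrite dot0l mulr_ge0 ?enorm_ge0.
  - by rewrite dotC dot0l mulr_ge0 ?enorm_ge0.
by rewrite -subr_ge0 -(pmulr_rge0 _ uv0); lra.
Qed.

Lemma norm_dot_le u v : `|dot u v| <= enorm u * enorm v.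
Proof.
rewrite ler_norml dot_le_enorm lerNl -dotNl andbT.
by rewrite (le_trans (dot_le_enorm _ _))// -scaleN1r enormZ normrN1 mul1r.
Qed.

End InnerProduct.

(** * First-order inequalities for smooth and convex functions *)

Section SmoothConvex.
Context {R : realType} {d : nat}.
Implicit Types (g : 'rV[R]_d -> R) (x y u v : 'rV[R]_d).

Lemma derive_dot_grad g x v : differentiable g x -> 'D_v g x = dot (grad g x) v.
Proof.
move=> dg; rewrite deriveE// [in LHS](row_sum_delta v) linear_sum/=.
apply: eq_bigr => j _.
by rewrite linearZ/= mxE deriveE// mulrC.
Qed.

(** The difference quotients along the line are those of [g] at [x + t *: v] in direction [v]; this
    gives access to one-variable calculus. *)
Lemma is_derive_line g x v (t : R) : differentiable g (x + t *: v) ->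
  is_derive t 1 (fun s : R => g (x + s *: v)) (dot (grad g (x + t *: v)) v).
Proof.
move=> dg.
pose phi (s : R) := g (x + s *: v).
have E : (fun h => h^-1 *: ((phi \o shift t) (h *: 1) - phi t)) =
         (fun h => h^-1 *: ((g \o shift (x + t *: v)) (h *: v)
                            - g (x + t *: v))).
  apply/funext => h /=; congr (_ *: (g _ - _)).
  by rewrite [h *: 1]mulr1 scalerDl addrCA.
split; first by rewrite /derivable E; exact: diff_derivable.
by rewrite -derive_dot_grad// /derive E.
Qed.

Lemma MVT_line g x v : (forall z, differentiable g z) ->
  exists2 t : R, 0 < t < 1 & g (x + v) - g x = dot (grad g (x + t *: v)) v.
Proof.
move=> dg.
have D (t : R) : is_derive t 1 (fun s : R => g (x + s *: v)) _ :=
  is_derive_line (dg _).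
have [|t] := MVT (@ltr01 R) (fun t _ => D t).
  by apply: derivable_within_continuous => t _.
rewrite in_itv/= scale1r scale0r addr0 subr0 mulr1 => t01 E.
by exists t.
Qed.

Lemma smoothW (L M : R) g : L <= M -> smooth L g -> smooth M g.
Proof.
move=> LM [dg Lg]; split=> // x y; apply: le_trans (Lg x y) _.
by rewrite ler_wpM2r ?enorm_ge0.
Qed.

Lemma smooth_dot (L : R) g x v (t : R) : smooth L g -> 0 <= t ->
  `|dot (grad g (x + t *: v) - grad g x) v| <= L * t * enorm v ^+ 2.
Proof.
move=> [_ Lg] t0; apply: le_trans (norm_dot_le _ _) _.
have := Lg (x + t *: v) x; rewrite [x + _]addrC addrK enormZ ger0_norm// => H.
by rewrite expr2 mulrA ler_wpM2r ?enorm_ge0// -mulrA.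
Qed.

(** Mean value theorem on $[0,1]$ for the restriction of [g] to the line minus [q]. The Lipschitz
    gradient lets the slope grow by at most $Lt|v|^2$, exactly the linear part of [dq], so the
    difference has derivative at most 0. *)
Lemma descent_lemma (L : R) g x v : smooth L g ->
  g (x + v) <= g x + dot (grad g x) v + L / 2 * enorm v ^+ 2.
Proof.
move=> Lg; have [dg _] := Lg.
pose q t := t * dot (grad g x) v + t ^+ 2 * (L / 2 * enorm v ^+ 2).
pose dq t := dot (grad g x) v + 2 * t * (L / 2 * enorm v ^+ 2).
have Dq (t : R) : is_derive t 1 q (dq t).
  rewrite /q; apply: is_derive_eq.
  by rewrite /dq /GRing.scale/= !mulr0 !add0r; ring.
have D (t : R) := is_deriveB (is_derive_line (dg (x + t *: v))) (Dq t).
have [|t] := MVT (@ltr01 R) (fun t _ => D t).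
  by apply: derivable_within_continuous => t _.
rewrite in_itv/= => /andP[t0 _].
rewrite !fctE /q /dq scale1r scale0r addr0 subr0 mulr1.
have := smooth_dot x v Lg (ltW t0); rewrite ler_norml => /andP[_].
by rewrite !dotE; lra.
Qed.

(* For v = y - x, convexity bounds g (x + s v) - g x by s (g y - g x), while the
   mean value theorem and the Lipschitz gradient bound it below by
   s <grad g x, v> - s^2 |L| |v|^2; then let s tend to 0. *)
Lemma convex_grad_le (L : R) g x y : @convex_function R 'rV[R]_d setT g ->
  smooth L g -> g x + dot (grad g x) (y - x) <= g y.
Proof.
move=> cg /(smoothW (ler_norm L)) Lg; have [dg _] := Lg.
set v := y - x; rewrite -subr_ge0 leNgt; apply/negP => e0.
set e := _ - _ in e0.
pose C := `|L| * enorm v ^+ 2.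
have C0 : 0 <= C by rewrite mulr_ge0 ?sqr_ge0.
have key (s : R) : 0 < s < 1 -> - e <= s * C.
  move=> /andP[s0 s1].
  have [t /andP[t0 t1] E] := MVT_line x (s *: v) dg.
  have := cg (Itv01 (ltW s0) (ltW s1)) y x.
  rewrite !inE => /(_ Logic.I Logic.I).
  rewrite convRE /= /conv /=.
  have -> : s *: y + (1 - s) *: x = x + s *: v.
    by rewrite /v scalerBr scalerBl scale1r addrA addrAC addrC addrA.
  move=> H.
  have {}H : g (x + s *: v) <= s * g y + (1 - s) * g x := H.
  have ts0 : 0 <= t * s by rewrite mulr_ge0 ?ltW.
  have := smooth_dot x v Lg ts0.
  have -> : `|L| * (t * s) * enorm v ^+ 2 = t * (s * C) by rewrite /C; ring.
  rewrite ler_norml dotDl dotNl => /andP[H1 _].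
  rewrite scalerA dotZr in E.
  have tC : t * (s * C) <= s * C by rewrite ler_piMl ?(ltW t1)// mulr_ge0// ltW.
  have {}E : s * dot (grad g (x + (t * s) *: v)) v <= s * (g y - g x).
    by rewrite -E; lra.
  by rewrite ler_pM2l// in E; rewrite /e; lra.
have e1 : 0 < - e by rewrite oppr_gt0.
(* Since [C < C - e + 1], this [s] gives [s * C < - e], against [key]. *)
have s01 : 0 < - e / (C - e + 1) < 1.
  by apply/andP; split; [apply: divr_gt0 => //; lra | rewrite ltr_pdivrMr; lra].
have := key _ s01; rewrite leNgt => /negP; apply.
rewrite mulrAC ltr_pdivrMr; last by lra.
nra.
Qed.

End SmoothConvex.

(** * One step with the stochastic Polyak step size *)

Section StochasticPolyakStep.
Context {R : realType} {d : nat}.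
Implicit Types (g : 'rV[R]_d -> R) (x y u v : 'rV[R]_d).

Lemma infval_le g x : has_lbound (range g) -> infval g <= g x.
Proof. by move=> gb; apply: ge_inf => //; exists x. Qed.

(** By the descent lemma a gradient step of length [M^-1] lowers [g] by at least $|\nabla
    g(x)|^2/(2M)$, and the value reached is still at least [infval g]. *)
Lemma sqr_grad_le (M : R) g x : 0 < M -> smooth M g -> has_lbound (range g) ->
  enorm (grad g x) ^+ 2 <= 2 * M * (g x - infval g).
Proof.
move=> M0 Mg gb.
have := le_trans (infval_le (x - M^-1 *: grad g x) gb) (descent_lemma _ _ Mg).
rewrite -scaleNr enormZ exprMn normrN real_normK ?num_real//.
rewrite dotZr -sqr_enorm mulNr.
have -> : M / 2 * (M^-1 ^+ 2 * enorm (grad g x) ^+ 2) =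
          2^-1 * (M^-1 * enorm (grad g x) ^+ 2) by field; rewrite gt_eqF.
set q := M^-1 * _ ^+ 2; have -> : enorm (grad g x) ^+ 2 = M * q.
  by rewrite /q mulrA divff ?mul1r ?gt_eqF.
move=> H; rewrite [_ * M]mulrC -mulrA ler_pM2l//.
by lra.
Qed.

(* Letting M tend to 0 in [sqr_grad_le]. *)
Lemma smooth_le0_grad (M : R) g x : M <= 0 -> smooth M g ->
  has_lbound (range g) -> grad g x = 0.
Proof.
move=> M0 Mg gb; apply/eqP; rewrite -enorm_eq0 -sqrf_eq0.
set q := _ ^+ 2; have q0 : 0 <= q by exact: sqr_ge0.
set D := g x - infval g.
have D0 : 0 <= D by rewrite subr_ge0 infval_le.
rewrite eq_le q0 andbT leNgt; apply/negP => qgt0.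
have D1 : 0 < D + 1 by lra.
(* With this smoothness constant the bound reads [q <= q * (D / (2 * (D + 1)))], whose factor is
   below 1. *)
have e0 : 0 < q / (2 * (D + 1)) / 2.
  by do 2!apply: divr_gt0 => //; exact: mulr_gt0.
have := sqr_grad_le x e0 (smoothW (le_trans M0 (ltW e0)) Mg) gb.
rewrite -/q -/D leNgt => /negP; apply.
have -> : 2 * (q / (2 * (D + 1)) / 2) * D = q * (D / (2 * (D + 1))).
  by field; lra.
by rewrite gtr_pMr// ltr_pdivrMr; lra.
Qed.

Lemma sgd_step_dist (M gamma_b : R) g x y :
    0 < M -> 0 < gamma_b -> @convex_function R 'rV[R]_d setT g ->
    smooth M g -> has_lbound (range g) ->
  enorm (sgd_step 1 gamma_b g x - y) ^+ 2 <=
  enorm (x - y) ^+ 2 - alpha 1 gamma_b M * (g x - g y)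
  + 2 * gamma_b * (g y - infval g).
Proof.
move=> M0 gb0 cg Mg gb.
have first := convex_grad_le x y cg Mg.
have Iy := infval_le y gb.
have Ix := infval_le x gb.
have a0 : 0 < alpha 1 gamma_b M.
  by rewrite /alpha lt_min gb0 andbT divr_gt0// !mulr_gt0.
rewrite /sgd_step; case: eqP => [g0|/eqP g0].
  (* A stationary point of a convex function is a minimizer; the point does not move, and both terms
     added to the squared distance are nonnegative. *)
  have gxy : g x <= g y by move: first; rewrite g0 dot0l addr0.
  have := mulr_ge0 (ltW a0) (_ : 0 <= g y - g x).
  have := mulr_ge0 (ltW gb0) (_ : 0 <= g y - infval g).
  rewrite !subr_ge0 => /(_ Iy) + /(_ gxy); lra.
have n0 : 0 < enorm (grad g x) ^+ 2.
  by rewrite exprn_gt0// lt_neqAle enorm_ge0 eq_sym enorm_eq0 g0.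
set s := sps_max _ _ _ _; set a := alpha _ _ _ in a0 *.
have sb : s <= gamma_b by rewrite /s /sps_max ge_min lexx orbT.
have as_ : a <= s.
  rewrite /a /s /alpha /sps_max le_min !ge_min lexx orbT andbT.
  apply/orP; left; rewrite !mulr1 !mul1r ler_pdivlMr// mulrC.
  rewrite ler_pdivrMr ?mulr_gt0// mulrC.
  exact: sqr_grad_le.
have sn : s * enorm (grad g x) ^+ 2 <= g x - infval g.
  by rewrite -ler_pdivlMr// /s /sps_max mul1r ge_min lexx.
have s0 : 0 <= s by apply: le_trans as_; exact: ltW.
have -> : enorm (x - s *: grad g x - y) ^+ 2 =
    enorm (x - y) ^+ 2 + 2 * s * dot (grad g x) (y - x)
    + s * (s * enorm (grad g x) ^+ 2).
  rewrite !sqr_enorm !dotE (dotC y x) (dotC x (grad _ _)) (dotC y (grad _ _)).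
  by ring.
have H1 := ler_wpM2l s0 sn.
have H2 : s * dot (grad g x) (y - x) <= s * (g y - g x).
  by rewrite ler_wpM2l//; lra.
(* The sign of [g x - g y] is unknown for a single component, so [s] cannot be replaced by [a]
   there. Both values are measured from [infval g] instead: $2s(g(y)-g(x))+s(g(x)-\inf
   g)=-s(g(x)-\inf g)+2s(g(y)-\inf g)$. *)
have H3 : a * (g x - infval g) <= s * (g x - infval g).
  by rewrite ler_wpM2r// subr_ge0.
have H4 : s * (g y - infval g) <= gamma_b * (g y - infval g).
  by rewrite ler_wpM2r// subr_ge0.
have H5 : 0 <= a * (g y - infval g) by rewrite mulr_ge0 ?(ltW a0)// subr_ge0.
lra.
Qed.

End StochasticPolyakStep.

(** * Averages over the component functions and Jensen's inequality *)

Section FiniteSumObjective.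
Context {R : realType} {n d : nat}.
Implicit Types (f : 'I_n.+1 -> 'rV[R]_d -> R) (x y : 'rV[R]_d).

Lemma averageD (a b : 'I_n.+1 -> R) :
  average (fun i => a i + b i) = average a + average b.
Proof. by rewrite /average big_split mulrDr. Qed.

Lemma averageZ (c : R) (a : 'I_n.+1 -> R) :
  average (fun i => c * a i) = c * average a.
Proof. by rewrite /average -mulr_sumr mulrCA. Qed.

Lemma average_cst (c : R) : average (fun _ : 'I_n.+1 => c) = c.
Proof.
rewrite /average sumr_const card_ord -[X in _ * X]mulr_natl mulrA.
by rewrite mulVf ?mul1r ?pnatr_eq0.
Qed.

Lemma le_average (a b : 'I_n.+1 -> R) :
  (forall i, a i <= b i) -> average a <= average b.
Proof. by move=> ab; rewrite ler_wpM2l ?invr_ge0 ?ler0n ?ler_sum. Qed.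

Lemma objectiveB f x y :
  objective f x - objective f y = average (fun i => f i x - f i y).
Proof. by rewrite /objective /average -mulrBr -sumrB. Qed.

Lemma average_step_dist f (M gamma_b : R) x y :
    0 < M -> 0 < gamma_b ->
    (forall i, @convex_function R 'rV[R]_d setT (f i)) ->
    (forall i, smooth M (f i)) -> (forall i, has_lbound (range (f i))) ->
  average (fun i => enorm (sgd_step 1 gamma_b (f i) x - y) ^+ 2) <=
  enorm (x - y) ^+ 2 - alpha 1 gamma_b M * (objective f x - objective f y)
  + 2 * gamma_b * sigma2 f y.
Proof.
move=> M0 gb0 cf Mf fb.
apply: le_trans (le_average (fun i =>
  sgd_step_dist x y M0 gb0 (cf i) (Mf i) (fb i))) _.
rewrite !averageD average_cst objectiveB -mulNr -!averageZ lerD2r lerD2l.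
by apply: le_average => i; rewrite mulNr.
Qed.

(** Each [f i] lies above its tangent at the mean [m], and the linear terms cancel because the
    deviations [x k - m] sum to zero. *)
Lemma objective_mean_le f (L : 'I_n.+1 -> R) (x : nat -> 'rV[R]_d) K :
    (0 < K)%N -> (forall i, @convex_function R 'rV[R]_d setT (f i)) ->
    (forall i, smooth (L i) (f i)) ->
  objective f (mean_iterate x K) <= K%:R^-1 * \sum_(k < K) objective f (x k).
Proof.
move=> K0 cf Lf; set m := mean_iterate x K.
have K0' : 0 < K%:R :> R by rewrite ltr0n.
rewrite mulrC ler_pdivlMr// /objective /average -mulr_sumr -mulrA.
rewrite ler_pM2l ?invr_gt0//.
rewrite exchange_big mulr_suml ler_sum// => i _.
pose G := grad (f i) m.
apply: (@le_trans _ _ (\sum_(k < K) (f i m + dot G (x k - m)))); last first.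
  by apply: ler_sum => k _; exact: convex_grad_le (cf i) (Lf i).
rewrite big_split/= sumr_const card_ord -[f i m *+ K]mulr_natr lerDl.
have -> : \sum_(k < K) dot G (x k - m) = dot G (\sum_(k < K) (x k - m)).
  by elim/big_rec2: _ => [|k u v _ ->]; rewrite ?dotDr// dotC dot0l.
rewrite sumrB sumr_const card_ord -scaler_nat /m /mean_iterate scalerA.
by rewrite divff ?gt_eqF// scale1r subrr dotC dot0l.
Qed.

(** Allows an infinite sequence of draws to be replaced by a finite list padded with a default
    index. *)
Lemma sgd_ext (c gamma_b : R) f x (i j : nat -> 'I_n.+1) K :
  (forall k, (k < K)%N -> i k = j k) ->
  sgd c gamma_b f x i K = sgd c gamma_b f x j K.
Proof.
elim: K => [//|K IH] ij /=; rewrite (ij K (ltnSn K)) IH// => k kK.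
exact: ij (ltnW _).
Qed.

End FiniteSumObjective.

(** * Uniform averages over tuples of indices *)

Section TupleAverage.
Context {R : realType} {n : nat}.
Local Notation I := 'I_n.+1.

Lemma big_tuple_rcons {A : nmodType} {T : finType} K (F : seq T -> A) :
  \sum_(t : K.+1.-tuple T) F t =
  \sum_(t : K.-tuple T) \sum_(i : T) F (rcons t i).
Proof.
rewrite pair_big/=.
pose h (p : K.-tuple T * T) : K.+1.-tuple T := [tuple of rcons p.1 p.2].
rewrite (reindex h)//=; apply: onW_bij; apply: inj_card_bij.
  by move=> [s i] [t j] /(congr1 val)/= /rcons_inj[/val_inj-> ->].
by rewrite card_prod !card_tuple expnSr.
Qed.

(** [F] takes sequences rather than [K]-tuples, so that one [F] serves every length. *)
Definition tuple_average K (F : seq I -> R) : R :=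
  (n.+1%:R ^+ K)^-1 * \sum_(t : K.-tuple I) F t.

Lemma tuple_average0 F : tuple_average 0 F = F [::].
Proof.
rewrite /tuple_average expr0 invr1 mul1r (big_pred1 [tuple])// => t.
exact/esym/eqP/tuple0.
Qed.

(** The tower property: the last draw is averaged first, with the past [s] fixed. *)
Lemma tuple_averageS K F :
  tuple_average K.+1 F =
  tuple_average K (fun s => average (fun i => F (rcons s i))).
Proof.
rewrite /tuple_average big_tuple_rcons /average -mulr_sumr mulrA.
by rewrite exprSr invfM.
Qed.

Lemma le_tuple_average K (F G : seq I -> R) :
  (forall s, size s = K -> F s <= G s) ->
  tuple_average K F <= tuple_average K G.
Proof.
move=> FG; rewrite ler_wpM2l ?invr_ge0 ?exprn_ge0// ler_sum// => t _.
by rewrite FG ?size_tuple.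
Qed.

Lemma tuple_averageD K (F G : seq I -> R) :
  tuple_average K (fun s => F s + G s) = tuple_average K F + tuple_average K G.
Proof. by rewrite /tuple_average big_split mulrDr. Qed.

Lemma tuple_averageZ K c (F : seq I -> R) :
  tuple_average K (fun s => c * F s) = c * tuple_average K F.
Proof. by rewrite /tuple_average -mulr_sumr mulrCA. Qed.

Lemma tuple_average_cst K c : tuple_average K (fun=> c) = c.
Proof.
elim: K => [|K IH]; first exact: tuple_average0.
by rewrite tuple_averageS; under eq_fun do rewrite average_cst.
Qed.

End TupleAverage.

(** * Expectations over the first draws as finite averages *)

Section ExpectationFiniteHorizon.
Context {R : realType} {disp : measure_display} {Omega : measurableType disp}.
Context (P : probability Omega R) {n : nat}.

(** The first [K] draws split [Omega] into cells [E t], each of mass $(n+1)^{-K}$ by independence.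
    The integrand is constant on each cell, hence a finite combination of indicators. *)
Lemma expectation_iid_uniform (I : nat -> Omega -> 'I_n.+1) K
    (F : seq 'I_n.+1 -> R) : iid_uniform P I ->
  ('E_P[fun w => F (mkseq (fun k => I k w) K)] = (tuple_average K F)%:E)%E.
Proof.
move=> [mI PI indI].
pose A (t : seq 'I_n.+1) k := [set nth ord0 t k].
pose E (t : seq 'I_n.+1) :=
  \bigcap_(k in [set` index_iota 0 K]) I k @^-1` A t k.
have mE t : measurable (E t) by apply: bigcap_measurableType => k _; exact: mI.
have PE t : P (E t) = ((n.+1%:R ^+ K)^-1)%:E.
  rewrite indI ?iota_uniq//.
  under eq_bigr do rewrite PI.
  by rewrite prodEFin prodr_const_nat subn0 exprVn.
have EP (t : K.-tuple 'I_n.+1) w :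
    \1_(E t) w = (mkseq (fun k => I k w) K == t)%:R :> R.
  rewrite indicE; congr (_%:R); congr nat_of_bool; apply/idP/eqP.
  - rewrite inE => Ew; apply: (@eq_from_nth _ ord0);
      rewrite size_mkseq ?size_tuple//.
    by move=> k kK; rewrite nth_mkseq// (Ew k)//= mem_index_iota.
  - move=> <-; rewrite inE => k /=.
    by rewrite mem_index_iota => /= kK; rewrite /A/= nth_mkseq.
have -> : (fun w => F (mkseq (fun k => I k w) K)) =
          (fun w => \sum_(t : K.-tuple 'I_n.+1) F t * \1_(E t) w).
  apply/funext => w.
  pose tw : K.-tuple 'I_n.+1 := [tuple of mkseq (fun k => I k w) K].
  rewrite (bigD1 tw)//= big1 => [|t twt]; rewrite EP ?eqxx ?mulr1 ?addr0//.
  by rewrite -val_eqE eq_sym in twt; rewrite (negPf twt) mulr0.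
rewrite unlock; under eq_integral do rewrite -sumEFin.
rewrite integral_sum//; last first.
  move=> t; under eq_fun do rewrite EFinM.
  by apply: integrableZl => //; exact: integrable_indic.
rewrite /tuple_average mulr_sumr -sumEFin; apply: eq_bigr => t _.
under eq_integral do rewrite EFinM.
rewrite integralZl ?integral_indic ?setIT//; last exact: integrable_indic.
by rewrite [X in (_ * X)%E](PE t) -EFinM mulrC.
Qed.

End ExpectationFiniteHorizon.

(** * Telescoping over the iterations *)

Section Convergence.
Context {R : realType} {n d : nat}.
Variables (f : 'I_n.+1 -> 'rV[R]_d -> R).
Hypothesis f_convex : forall i, @convex_function R 'rV[R]_d setT (f i).
Hypothesis f_bounded_below : forall i, has_lbound (range (f i)).

(** The potential adds to the squared distance the gaps accumulated so far, weighted by [alpha]; one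
    step raises its average by at most [2 * gamma_b * sigma2 f y]. *)
Lemma sgd_potential (M gamma_b : R) x0 y K :
    0 < M -> 0 < gamma_b -> (forall i, smooth M (f i)) ->
  tuple_average K (fun s => let x := sgd 1 gamma_b f x0 (nth ord0 s) in
    enorm (x K - y) ^+ 2 +
    alpha 1 gamma_b M * \sum_(k < K) (objective f (x k) - objective f y)) <=
  enorm (x0 - y) ^+ 2 + K%:R * (2 * gamma_b * sigma2 f y).
Proof.
move=> M0 gb0 Mf; elim: K => [|K IH].
  by rewrite tuple_average0/= big_ord0 mulr0 mul0r.
rewrite tuple_averageS -natr1 mulrDl mul1r addrA.
rewrite -[X in _ + X](tuple_average_cst (n := n) K).
apply: le_trans (lerD IH (lexx _)); rewrite -tuple_averageD.
apply: le_tuple_average => s sK /=.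
(* Iterate [K] is determined before the appended draw; only iterate [K.+1] sees it. *)
have prefix i k : (k <= K)%N ->
    sgd 1 gamma_b f x0 (nth ord0 (rcons s i)) k =
    sgd 1 gamma_b f x0 (nth ord0 s) k.
  by move=> kK; apply: sgd_ext => j jk; rewrite nth_rcons sK (leq_trans jk kK).
under eq_fun => i.
  rewrite nth_rcons sK ltnn eqxx prefix//.
  under eq_bigr => k _ do rewrite prefix -1?ltnS//.
  over.
rewrite averageD average_cst big_ord_recr/= mulrDr.
have := average_step_dist (sgd 1 gamma_b f x0 (nth ord0 s) K) y M0 gb0
  f_convex Mf f_bounded_below.
lra.
Qed.

(** Divide the potential bound by [alpha * K], drop the final squared distance, and pass to the mean
    iterate by Jensen's inequality. *)
Lemma objective_gap_le (M gamma_b : R) x0 y K :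
    0 < M -> 0 < gamma_b -> (forall i, smooth M (f i)) -> (0 < K)%N ->
  tuple_average K (fun s =>
    objective f (mean_iterate (sgd 1 gamma_b f x0 (nth ord0 s)) K)
    - objective f y) <=
  enorm (x0 - y) ^+ 2 / (alpha 1 gamma_b M * K%:R)
  + 2 * sigma2 f y * gamma_b / alpha 1 gamma_b M.
Proof.
move=> M0 gb0 Mf K0.
have K0' : 0 < K%:R :> R by rewrite ltr0n.
have := sgd_potential x0 y K M0 gb0 Mf.
set a := alpha _ _ _ => H.
have a0 : 0 < a by rewrite /a /alpha lt_min gb0 andbT divr_gt0// !mulr_gt0.
have -> : enorm (x0 - y) ^+ 2 / (a * K%:R) + 2 * sigma2 f y * gamma_b / a =
    (a * K%:R)^-1 * (enorm (x0 - y) ^+ 2 + K%:R * (2 * gamma_b * sigma2 f y)).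
  by field; rewrite !gt_eqF.
apply: le_trans (ler_wpM2l _ H); last by rewrite invr_ge0 ltW ?mulr_gt0.
rewrite -tuple_averageZ; apply: le_tuple_average => s _ /=.
set x := sgd _ _ _ _ _.
have aK0 : 0 <= (a * K%:R)^-1 by rewrite invr_ge0 ltW ?mulr_gt0.
rewrite mulrDr ler_wpDl ?(mulr_ge0 aK0) ?exprn_even_ge0//.
rewrite sumrB sumr_const card_ord -[objective f y *+ K]mulr_natl.
have -> : (a * K%:R)^-1 *
    (a * (\sum_(k < K) objective f (x k) - K%:R * objective f y)) =
    K%:R^-1 * \sum_(k < K) objective f (x k) - objective f y.
  by field; rewrite !gt_eqF.
by rewrite lerD2r; exact: objective_mean_le K0 f_convex Mf.
Qed.

(** The gradient vanishes everywhere, so the tangent inequality in both directions gives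
    equality. *)
Lemma smooth_le0_const (M : R) i x y : M <= 0 -> smooth M (f i) ->
  f i x = f i y.
Proof.
move=> M0 Mf; have g0 z := smooth_le0_grad z M0 Mf (f_bounded_below i).
apply/le_anti/andP; split.
- by have := convex_grad_le x y (f_convex i) Mf; rewrite g0 dot0l addr0.
- by have := convex_grad_le y x (f_convex i) Mf; rewrite g0 dot0l addr0.
Qed.

End Convergence.

Theorem theorem3p4 (R : realType) (n d : nat)
    (f : 'I_n.+1 -> 'rV[R]_d -> R) (L : 'I_n.+1 -> R)
    (f_convex : forall i, @convex_function R 'rV[R]_d setT (f i))
    (f_smooth : forall i, smooth (L i) (f i))
    (f_bounded_below : forall i, has_lbound (range (f i)))
    (xs : 'rV[R]_d)
    (xs_minimizer : forall x, objective f xs <= objective f x)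
    (gamma_b : R) (gamma_b_gt0 : 0 < gamma_b)
    (disp : measure_display) (Omega : measurableType disp)
    (P : probability Omega R) (I : nat -> Omega -> 'I_n.+1)
    (I_iid_uniform : iid_uniform P I)
    (x0 : 'rV[R]_d) (K : nat) (K_ge1 : (1 <= K)%N) :
  let c := 1 in
  let a := alpha c gamma_b (max_const L) in
  let x := fun (w : Omega) => sgd c gamma_b f x0 (fun k => I k w) in
  ('E_P[fun w => (objective f (mean_iterate (x w) K) - objective f xs)%R]
    <= ((enorm (x0 - xs) ^+ 2 / (a * K%:R)
        + 2 * sigma2 f xs * gamma_b / a)%R)%:E)%E.
Proof.
cbv zeta; set a := alpha _ _ _.
pose x w := sgd 1 gamma_b f x0 (fun k => I k w).
rewrite -[X in ('E_P[X])%E]/(fun w =>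
  objective f (mean_iterate (x w) K) - objective f xs).
pose M := max_const L.
have LM i : L i <= M by apply: le_bigmax.
have Mf i : smooth M (f i) := smoothW (LM i) (f_smooth i).
have [M0|M0] := ltP 0 M.
  pose F s := objective f (mean_iterate (sgd 1 gamma_b f x0 (nth ord0 s)) K)
              - objective f xs.
  have -> : (fun w => objective f (mean_iterate (x w) K) - objective f xs) =
            (fun w => F (mkseq (fun k => I k w) K)).
    apply/funext => w; rewrite /F /mean_iterate.
    congr (objective _ (_ *: _) - _); apply: eq_bigr => k _.
    by apply: sgd_ext => j jk; rewrite nth_mkseq// (ltn_trans jk).
  rewrite expectation_iid_uniform// lee_fin.
  exact: objective_gap_le.
(* Degenerate case [M <= 0]: the gap and [sigma2 f xs] both vanish, which leaves only the sign of
   the distance term to check. *)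
have fc i z : f i z = f i xs :=
  smooth_le0_const f_convex f_bounded_below z xs M0 (Mf i).
have -> :
    (fun w => objective f (mean_iterate (x w) K) - objective f xs) = cst 0.
  apply/funext => w /=; rewrite objectiveB.
  by under eq_fun do rewrite fc subrr; rewrite average_cst.
rewrite expectation_cst lee_fin.
have -> : sigma2 f xs = 0.
  rewrite /sigma2 -[RHS](average_cst (n := n)); congr average.
  apply/funext => i.
  rewrite /infval (_ : range (f i) = [set f i xs]) ?inf1 ?subrr//.
  by apply/seteqP; split=> [_ [z _ <-]|_ ->]; [exact: fc | exists xs].
rewrite mulr0 !mul0r addr0.
move: M0; rewrite le_eqVlt => /predU1P[M0|M0].
  (* The convention [1 / 0 = 0] makes [a], and with it the distance term, zero. *)
  have -> : a = 0.
    by rewrite /a /alpha -/M M0 mulr0 invr0 mulr0; apply/min_idPl/ltW.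
  by rewrite mul0r invr0 mulr0.
(* Now [a] is negative, so the numerator has to vanish: a negative Lipschitz constant forces any two
   points to coincide. *)
suff -> : enorm (x0 - xs) = 0 by rewrite expr0n mul0r.
have [_ /(_ x0 xs) Lip] := Mf ord0.
apply/eqP; rewrite eq_le enorm_ge0 andbT -(nmulr_rge0 _ M0).
exact: le_trans (enorm_ge0 _) Lip.
Qed.
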